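(* Let $\mathcal P\subset\mathbb R^2$ be a set of at least four points, each coloured either red or blue, and suppose that $\mathcal P$ determines only finitely many tropical lines, i.e. only finitely many tropical lines contain at least two points of $\mathcal P$. Then $\mathcal P$ determines a monochromatic tropical line: there exists a tropical line containing at least two points of $\mathcal P$ such that all points of $\mathcal P$ lying on it have the same colour.
   Context: A tropical line with center $(a,b)\in\mathbb R^2$ is the corner locus (locus of non-differentiability) of $g(x,y)=\max\{x-a,\,y-b,\,0\}$; equivalently it is the union of the three closed rays from $(a,b)$ in the directions $(1,1)$, $(-1,0)$, $(0,-1)$. *)

(* Defs.v *)
From mathcomp Require Import all_boot all_order all_algebra.
From mathcomp Require Import all_classical all_reals all_analysis.
Import Order.TTheory GRing.Theory Num.Theory.
Import numFieldNormedType.Exports.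
Set Implicit Arguments.
Unset Strict Implicit.
Unset Printing Implicit Defensive.
Local Open Scope classical_set_scope.
Local Open Scope ring_scope.

Definition tropical_linear_form (R : realType) (c p : R * R) : R :=
  Num.max (Num.max (p.1 - c.1) (p.2 - c.2)) 0.

(* The corner locus of the form: the points of the plane where it is not
   (Frechet) differentiable. *)
Definition tropical_line (R : realType) (c : R * R) : set (R * R) :=
  [set p | ~ differentiable (tropical_linear_form c) p].

(* Lines are plane sets here, so that counting them does not depend on how a
   line is presented. *)
Definition determines (R : realType) (P L : set (R * R)) : Prop :=
  (exists c : R * R, L = tropical_line c) /\ (`I_2 #<= P `&` L)%card.

Inductive colour : Set := Red | Blue.

(* The colouring is total, but only its values on P are used. *)
Definition monochromatic (R : realType) (P : set (R * R))
    (col : R * R -> colour) (L : set (R * R)) : Prop :=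
  exists k : colour, forall p, (P `&` L) p -> col p = k.

(* Main.v *)
Require Import Defs.
From mathcomp Require Import all_boot all_order all_algebra.
From mathcomp Require Import all_classical all_reals all_analysis.
From mathcomp Require Import lra.
Import Order.TTheory GRing.Theory Num.Theory.
Import numFieldNormedType.Exports.
Local Open Scope classical_set_scope.
Local Open Scope ring_scope.

(* Two points that share a coordinate x, y or x - y lie on infinitely many
   tropical lines, so finiteness makes P generic: any two points span exactly
   one tropical line, each ray of a line carries at most one point of P, hence
   a line carries at most three, and P is finite.
   Suppose no line is monochromatic.  Two points of equal colour then have a
   third point of the other colour on their line.  For fixed p, sending q to
   that third point on the line pq injects the points q <> p coloured like p
   into the other colour class.  Let b be a majority colour.  If two points c, d
   have the other colour, take p to be the third point on the line cd: the
   injection from p avoids c and d, which contradicts majority.  So the minority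
   has at most one point, and then the injection from any p leaves at most two
   points of colour b. *)

(** * Two-coloured finite linear spaces with at most three points on a line *)

Section LinearSpace.
Variables (T : eqType) (I : Type) (on : I -> T -> Prop) (s : seq T).
Variable red : pred T.
Hypothesis uniq_s : uniq s.
Hypothesis join : forall x y, x \in s -> y \in s -> x != y ->
  exists l, on l x /\ on l y.
Hypothesis join_uniq : forall l m x y, x \in s -> y \in s -> x != y ->
  on l x -> on l y -> on m x -> on m y -> l = m.
Hypothesis line_le3 : forall l t, uniq t -> {subset t <= s} ->
  (forall x, x \in t -> on l x) -> (size t <= 3)%N.
Hypothesis bichromatic : forall l x y, x \in s -> y \in s -> x != y ->
  on l x -> on l y -> red x = red y ->
  exists z, [/\ z \in s, on l z & red z != red x].

Let class b := [seq x <- s | red x == b].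

(* [t] collects points of the other colour known to be missed by the injection. *)
Lemma pencil_injection p t : p \in s -> uniq t -> {subset t <= class (~~ red p)} ->
  (forall q z l, q \in class (red p) -> q != p -> z \in t ->
     on l p -> on l q -> on l z -> False) ->
  (size t + size (class (red p)) <= (size (class (~~ red p))).+1)%N.
Proof.
move=> ps ut tS avoid.
(* The conditions on [q] sit under the existential so that [choice] returns a total function;
   elsewhere its value is a dummy. *)
have third q : exists z, q \in class (red p) -> q != p ->
    [/\ z \in class (~~ red p) & exists l, [/\ on l p, on l q & on l z]].
  case: (boolP ((q \in class (red p)) && (q != p))) => [/andP[]|]; last first.
    by move=> h; exists q => h1 h2; rewrite h1 h2 in h.
  rewrite mem_filter => /andP[/eqP qp qs] qNp.
  have [l [lq lp]] := join _ _ qs ps qNp.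
  have [z [zs lz zq]] := bichromatic _ _ _ qs ps qNp lq lp qp.
  exists z => _ _; split; last by exists l.
  by rewrite mem_filter zs andbT; move: zq; rewrite qp; case: (red z); case: (red p).
have [f fP] := choice third.
have up : uniq (class (red p)) by rewrite filter_uniq.
have pc : p \in class (red p) by rewrite mem_filter eqxx.
set r := rem p (class (red p)).
have rP q : q \in r -> q \in class (red p) /\ q != p.
  by rewrite mem_rem_uniq // inE => /andP[].
have cls b x : x \in class b -> x \in s /\ red x = b.
  by rewrite mem_filter => /andP[/eqP].
have inj : {in r &, injective f}.
  move=> q q' /rP[qc qp] /rP[qc' qp'] ff.
  have [zc [l [lp lq lz]]] := fP _ qc qp.
  have [_ [m [mp mq mz]]] := fP _ qc' qp'.
  rewrite -ff in mz.
  have [[[zs zr] [qs qr]] [qs' qr']] := (cls _ _ zc, cls _ _ qc, cls _ _ qc').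
  have zN x : red x = red p -> x != f q.
    by move=> xr; apply/eqP => xz; move: zr; rewrite -xz xr; case: (red p).
  (* Both lines join [p] to the common image, so they coincide; distinct [q] and [q'] would then
     give four points on one line. *)
  have lm : l = m by apply: (join_uniq _ _ _ _ ps zs (zN _ _)).
  subst m; apply/eqP; apply: contraT => qq'.
  suff : (size [:: p; q; q'; f q] <= 3)%N by [].
  apply: (@line_le3 l).
  - by rewrite /= !inE !negb_or qq' !zN // eq_sym qp eq_sym qp'.
  - by move=> x; rewrite !inE => /or4P[] /eqP ->.
  - by move=> x; rewrite !inE => /or4P[] /eqP ->.
have -> : size (class (red p)) = (size r).+1.
  by rewrite size_rem // prednK //; case: (class _) pc.
rewrite addnS ltnS addnC -(size_map f r) -size_cat.
apply: uniq_leq_size.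
  rewrite cat_uniq map_inj_in_uniq // rem_uniq // ut andbT /=.
  apply/hasPn => z zt; apply/negP => /mapP[q /rP[qc qp] zf].
  have [_ [l [lp lq lz]]] := fP _ qc qp.
  by apply: (avoid q z l) => //; rewrite zf.
move=> x; rewrite mem_cat => /orP[/mapP[q /rP[qc qp] ->]|/tS //].
by have [] := fP _ qc qp.
Qed.

Lemma majority_le b : (size (class (~~ b)) <= size (class b))%N ->
  (size s <= 3)%N.
Proof.
move=> le_b.
have szs : size s = (size (class b) + size (class (~~ b)))%N.
  rewrite !size_filter -(count_predC (fun x => red x == b) s); congr (_ + _)%N.
  by apply: eq_count => x /=; case: (red x); case: b {le_b}.
have cls b' x : x \in class b' -> x \in s /\ red x = b'.
  by rewrite mem_filter => /andP[/eqP].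
(* In the first two cases the injection with empty [t] leaves at most one, respectively two, points
   of colour [b]. *)
case E : (class (~~ b)) => [|c [|d t]].
- rewrite szs E addn0; case F : (class b) => [//|p u].
  have [ps pb] : p \in s /\ red p = b by apply: cls; rewrite F mem_head.
  have := @pencil_injection p [::] ps isT; rewrite pb E F /= => H.
  by apply: ltnW; apply: ltnW; apply: H.
- rewrite szs E addn1; case F : (class b) => [//|p u].
  have [ps pb] : p \in s /\ red p = b by apply: cls; rewrite F mem_head.
  have := @pencil_injection p [::] ps isT; rewrite pb E F /= => H.
  by apply: H.
- exfalso.
  have cc : c \in class (~~ b) by rewrite E mem_head.
  have dc : d \in class (~~ b) by rewrite E !inE eqxx orbT.
  have [[cs cr] [ds dr]] := (cls _ _ cc, cls _ _ dc).
  have cd : c != d.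
    have : uniq (class (~~ b)) by rewrite filter_uniq.
    by rewrite E /= inE negb_or => /andP[/andP[]].
  have [l [lc ld]] := join _ _ cs ds cd.
  have [p [ps lp pr]] := bichromatic _ _ _ cs ds cd lc ld (etrans cr (esym dr)).
  have pb : red p = b by move: pr; rewrite cr; case: (red p); case: b {le_b szs E cc dc cr dr}.
  have NN x y : red x = b -> red y = ~~ b -> x != y.
    by move=> xb yb; apply/eqP => xy; move: yb; rewrite -xy xb; case: b {le_b szs E cc dc cr dr xb pb}.
  have := @pencil_injection p [:: c; d] ps; rewrite pb /= inE cd => /(_ isT).
  (* A line through [p], [q] and one of [c], [d] shares two points with [l], hence is [l], which
     would carry four points. *)
  have avoid q z m : q \in class b -> q != p -> z \in [:: c; d] ->
      on m p -> on m q -> on m z -> False.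
    move=> /cls[qs qb] qp zcd mp mq mz.
    have [zs [zb lz]] : z \in s /\ red z = ~~ b /\ on l z.
      by move: zcd; rewrite !inE => /orP[] /eqP ->.
    have ml : m = l by apply: (join_uniq _ _ _ _ ps zs (NN _ _ pb zb)).
    subst m.
    suff : (size [:: p; q; c; d] <= 3)%N by [].
    apply: (@line_le3 l).
    - by rewrite /= !inE !negb_or (NN p c) ?(NN p d) ?(NN q c) ?(NN q d) // cd eq_sym qp.
    - by move=> x; rewrite !inE => /or4P[] /eqP ->.
    - by move=> x; rewrite !inE => /or4P[] /eqP ->.
  (* Two missed points against a slack of one make the class of [b] strictly smaller than the
     other. *)
  move=> H; have {H}: (2 + size (class b) <= (size (class (~~ b))).+1)%N.
    by apply: H => // x; rewrite !inE => /orP[] /eqP ->.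
  by rewrite ltnS ltnNge le_b.
Qed.

Lemma bichromatic_size_le3 : (size s <= 3)%N.
Proof.
have [|/ltnW] := leqP (size (class (~~ true))) (size (class true)).
  exact: majority_le.
exact: (@majority_le false).
Qed.

End LinearSpace.

(** * The corner locus as a union of three rays *)

Lemma near_eq_differentiable (R : numFieldType) (V W : normedModType R)
    (f g : V -> W) (x : V) :
  (\forall y \near x, f y = g y) -> differentiable g x -> differentiable f x.
Proof.
move=> fg dg.
have fx : f x = g x by exact: nbhs_singleton fg.
have [dc /eqaddoP go] := (diff_locallyP x g).1 dg.
have fo : f \o shift x = cst (f x) + 'd g x +o_ 0 id.
  apply/eqaddoP => e e0; near=> h.
  have -> : (f \o shift x - (cst (f x) + 'd g x)) h =
            (g \o shift x - (cst (g x) + 'd g x)) h.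
    rewrite /= !fctE /= fx; congr (_ - _); near: h.
    by move: fg; rewrite (near_shift 0 x) subr0.
  by near: h; exact: go.
(* By uniqueness of the differential, the expansion [fo] identifies ['d f x] with ['d g x]. *)
have du := diff_unique dc fo.
by apply/diff_locallyP; rewrite du.
Unshelve. all: by end_near. Qed.

(** The difference quotient along [v] is 1 for positive and 0 for negative [t]; no limit lies within
    1/2 of both. *)
Lemma kink_not_differentiable (R : realType) (V : normedModType R)
    (f : V -> R) (x v : V) :
  (forall t : R, f (t *: v + x) = f x + Num.max t 0) -> ~ differentiable f x.
Proof.
move=> fE /diff_derivable - /(_ v) /cvg_ex[l /cvgrPdist_lt /(_ (2^-1))].
have h2 : 0 < 2^-1 :> R by rewrite invr_gt0.
move=> /(_ h2) /nbhs_ballP [e /= e0 H].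
have e20 : 0 < e / 2 by rewrite divr_gt0.
have B (t : R) : `|t| = e / 2 -> ball (0 : R) e t.
  by move=> te; rewrite -ball_normE /= sub0r normrN te; lra.
have tN (t : R) : `|t| = e / 2 -> t != 0 by rewrite -normr_gt0 => ->.
have np : `|e / 2| = e / 2 by rewrite gtr0_norm.
have nn : `|- (e / 2)| = e / 2 by rewrite normrN.
have := H _ (B _ np) (tN _ np); have := H _ (B _ nn) (tN _ nn).
rewrite /= !fE !(addrC (f x)) !addrK (max_l (ltW e20)) max_r ?oppr_le0 ?(ltW e20) //.
rewrite scaler0 subr0 /GRing.scale /= mulVf ?gt_eqF //.
by rewrite !ltr_norml => /andP[? ?] /andP[? ?]; lra.
Qed.

Lemma differentiable_fst {R : numFieldType} (V W : normedModType R) (p : V * W) :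
  differentiable (fst : V * W -> V) p.
Proof. by apply: linear_differentiable => q; exact: cvg_fst. Qed.

Lemma differentiable_snd {R : numFieldType} (V W : normedModType R) (p : V * W) :
  differentiable (snd : V * W -> W) p.
Proof. by apply: linear_differentiable => q; exact: cvg_snd. Qed.

(** A maximum is split only when its left argument contains none, so left-nested maxima are resolved
    from the inside. *)
Ltac max_lra := rewrite ?fctE /=; repeat match goal with
  | |- context [Num.max ?a ?b] =>
    lazymatch a with context [Num.max _ _] => fail | _ => case: (leP a b) => ? end
  end; lra.

(** The closed rays in directions (1,1), (0,-1) and (-1,0), in this order, in a form suited to
    linear arithmetic. *)
Definition on_rays {R : realType} (c p : R * R) :=
  [\/ p.1 - c.1 = p.2 - c.2 /\ c.1 <= p.1,
      p.1 = c.1 /\ p.2 <= c.2 |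
      p.2 = c.2 /\ p.1 <= c.1].

(** Off the rays one of the three affine terms is strictly largest, and stays so nearby, so the form
    is locally affine. On a ray, moving along a coordinate axis that crosses it produces a kink. *)
Lemma tropical_line_raysP {R : realType} (c p : R * R) :
  tropical_line c p <-> on_rays c p.
Proof.
split.
- apply: contra_notP => off.
  have cf : (fst : R * R -> R) @ p --> p.1 by exact: cvg_fst.
  have cs : (snd : R * R -> R) @ p --> p.2 by exact: cvg_snd.
  have df := differentiable_fst R R p.
  have ds := differentiable_snd R R p.
  have [[u0 v0]|[[u0 uv]|[v0 vu]]] : (p.1 < c.1 /\ p.2 < c.2) \/
      (c.1 < p.1 /\ p.2 - p.1 < c.2 - c.1) \/
      (c.2 < p.2 /\ p.1 - p.2 < c.1 - c.2).
    have [u0|u0|u0] := ltgtP p.1 c.1; have [v0|v0|v0] := ltgtP p.2 c.2;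
      try (by left); try (by right; left; split=> //; lra);
      try (by right; right; split=> //; lra);
      try (by exfalso; apply: off; rewrite /on_rays ?u0 ?v0 ?lexx;
           first [apply: Or32; split => //; lra | apply: Or33; split => //; lra ]).
    have [w|w|w] := ltgtP (p.1 - c.1) (p.2 - c.2).
    + by right; right; split=> //; lra.
    + by right; left; split=> //; lra.
    + by exfalso; apply: off; apply: Or31; split => //; lra.
  + apply: (@near_eq_differentiable _ _ _ _ (cst 0)); last exact: differentiable_cst.
    near=> q; rewrite /tropical_linear_form.
    have ? : q.1 < c.1 by near: q; apply: cvgr_lt cf _ u0.
    have ? : q.2 < c.2 by near: q; apply: cvgr_lt cs _ v0.
    by max_lra.
  + apply: (@near_eq_differentiable _ _ _ _ (fst - cst c.1)).
      near=> q; rewrite /tropical_linear_form.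
      have ? : c.1 < q.1 by near: q; apply: cvgr_gt cf _ u0.
      have ? : q.2 - q.1 < c.2 - c.1 by near: q; apply: cvgr_lt (cvgB cs cf) _ uv.
      by max_lra.
    by apply: differentiableB df _; exact: differentiable_cst.
  + apply: (@near_eq_differentiable _ _ _ _ (snd - cst c.2)).
      near=> q; rewrite /tropical_linear_form.
      have ? : c.2 < q.2 by near: q; apply: cvgr_gt cs _ v0.
      have ? : q.1 - q.2 < c.1 - c.2 by near: q; apply: cvgr_lt (cvgB cf cs) _ vu.
      by max_lra.
    by apply: differentiableB ds _; exact: differentiable_cst.
- case=> [[uv u0]|[u0 v0]|[v0 u0]].
  + apply: (@kink_not_differentiable R (R * R)%type _ p (1, 0)) => t.
    rewrite /tropical_linear_form /= [t *: 1]mulr1 [t *: 0]mulr0 add0r -addrA -uv.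
    rewrite -subr_ge0 in u0; rewrite maxxx (max_l u0) max_l ?le_max ?u0 ?orbT //.
    by rewrite addr_maxr addr0 addrC.
  + apply: (@kink_not_differentiable R (R * R)%type _ p (1, 0)) => t.
    rewrite -subr_le0 in v0.
    rewrite /tropical_linear_form /= [t *: 1]mulr1 [t *: 0]mulr0 add0r -addrA.
    by rewrite -!maxA (max_r v0) u0 subrr addr0 maxxx add0r.
  + apply: (@kink_not_differentiable R (R * R)%type _ p (0, 1)) => t.
    rewrite -subr_le0 in u0.
    rewrite /tropical_linear_form /= [t *: 1]mulr1 [t *: 0]mulr0 add0r -addrA.
    by rewrite -!maxA v0 subrr addr0 maxxx (max_r u0) add0r maxCA (max_r u0).
Unshelve. all: by end_near. Qed.

(** A center lies on its own line, so equal lines place each center on the rays of the other, which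
    forces equality. Counting lines thus reduces to counting centers. *)
Lemma tropical_line_inj {R : realType} : injective (@tropical_line R).
Proof.
move=> c d cd.
have [cc dd] : on_rays c c /\ on_rays d d by split; apply: Or32; rewrite lexx.
have cond : on_rays d c by apply/tropical_line_raysP; rewrite -cd; exact/tropical_line_raysP.
have donc : on_rays c d by apply/tropical_line_raysP; rewrite cd; exact/tropical_line_raysP.
have [e1 e2] : c.1 = d.1 /\ c.2 = d.2.
  by split; move: cond donc => [[? ?]|[? ?]|[? ?]] [[? ?]|[? ?]|[? ?]]; lra.
by rewrite (surjective_pairing c) (surjective_pairing d) e1 e2.
Qed.

(** * Cardinality of sets and sequences *)

Lemma card_ge2P {T : eqType} (A : set T) :
  (`I_2 #<= A)%card <-> exists x y, [/\ A x, A y & x != y].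
Proof.
split=> [/pcard_surjP[g gA]|[x [y [Ax Ay xy]]]].
  have [x Ax gx] : (g @` A) 0%N by exact: gA.
  have [y Ay gy] : (g @` A) 1%N by exact: gA.
  by exists x, y; split=> //; apply/eqP => xy; move: gy; rewrite -xy gx.
apply/pcard_surjP; exists (fun z => (z != x) : nat) => -[|[|//]] _.
  by exists x => //=; rewrite eqxx.
by exists y => //=; rewrite eq_sym xy.
Qed.

Lemma card_ge_size {T : eqType} (s : seq T) n :
  (`I_n #<= [set` s])%card -> (n <= size s)%N.
Proof.
move=> /pcard_surjP[g gs]; rewrite -(size_map g s) -(size_iota 0 n).
apply: uniq_leq_size (iota_uniq _ _) _ => k; rewrite mem_iota /= add0n => kn.
by have [x xs <-] := gs k kn; exact: map_f.
Qed.

Lemma infinite_range {T : eqType} (A : set T) (g : nat -> T) :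
  injective g -> (forall n, A (g n)) -> infinite_set A.
Proof.
move=> gI gA /finite_seqP[s sA].
suff : (size (mkseq g (size s).+1) <= size s)%N by rewrite size_mkseq ltnn.
apply: uniq_leq_size; first exact: mkseq_uniq.
by move=> _ /mapP[n _ ->]; have := gA n; rewrite sA.
Qed.

(** * Incidence of points and tropical lines *)

Lemma tropical_line_through {R : realType} (p q : R * R) :
  exists c, on_rays c p /\ on_rays c q.
Proof.
move: p q => [p1 p2] [q1 q2].
(* Each center is where two reversed rays meet, one from each point; the sign of [y - b] and its
   comparison with [x - a] select the pair. *)
have W a b x y : a <= x -> exists c : R * R, on_rays c (a, b) /\ on_rays c (x, y).
  move=> ax; have [yb|yb] := leP y b.
    by exists (x, b); split; [apply: Or33|apply: Or32].
  have [xy|xy] := leP (x - a) (y - b).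
    exists (a, y - (x - a)); split; [apply: Or32 | apply: Or31]; split => //=; lra.
  exists (x - (y - b), b); split; [apply: Or33 | apply: Or31]; split => //=; lra.
have [/W|/ltW/W H] := leP p1 q1; first exact.
by have [c []] := H q2 p2; exists c.
Qed.

(** Two points on a common ray agree in one of these three quantities, so generic points never share
    a ray. *)
Definition generic {R : realType} (p q : R * R) :=
  [&& p.1 != q.1, p.2 != q.2 & p.1 - p.2 != q.1 - q.2].

(** Generic points occupy different rays, so two non-parallel classical lines fix the center. If [c]
    and [d] assign the rays differently, the inequalities leave a shared coordinate or [c = d]. *)
Lemma on_rays_uniq {R : realType} (c d p q : R * R) : generic p q ->
  on_rays c p -> on_rays c q -> on_rays d p -> on_rays d q -> c = d.
Proof.
move=> /and3P[/eqP n1 /eqP n2 /eqP n3] cp cq dp dq.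
suff [e1 e2] : c.1 = d.1 /\ c.2 = d.2.
  by rewrite (surjective_pairing c) (surjective_pairing d) e1 e2.
move: cp cq => [[? ?]|[? ?]|[? ?]] [[? ?]|[? ?]|[? ?]];
  try (by exfalso; first [apply: n1; lra|apply: n2; lra|apply: n3; lra]);
move: dp dq => [[? ?]|[? ?]|[? ?]] [[? ?]|[? ?]|[? ?]];
  try (by exfalso; first [apply: n1; lra|apply: n2; lra|apply: n3; lra]);
  split; lra.
Qed.

Lemma generic_line_le3 {R : realType} (c : R * R) (t : seq (R * R)) : uniq t ->
  {in t &, forall p q, p != q -> generic p q} ->
  (forall p, p \in t -> on_rays c p) -> (size t <= 3)%N.
Proof.
move=> ut gt ct.
(* A point on several rays gets the first matching number. Equal numbers contradict genericity, so
   [ray] injects [t] into three values. *)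
pose ray (p : R * R) : nat :=
  if p.1 - c.1 == p.2 - c.2 then 0 else if p.1 == c.1 then 1 else 2.
have rayP p : p \in t -> [\/ ray p = 0%N /\ p.1 - c.1 = p.2 - c.2,
    ray p = 1%N /\ p.1 = c.1 | ray p = 2%N /\ p.2 = c.2].
  move=> /ct; rewrite /ray /on_rays; case: eqP => [|n1]; first by constructor 1.
  case: eqP => [|n2]; first by constructor 2.
  by case=> [[]|[]|[]] // ->; constructor 3.
rewrite -(size_map ray t) -(size_iota 0 3); apply: uniq_leq_size.
  rewrite map_inj_in_uniq // => p q pt qt pq; apply/eqP; apply: contraT.
  move=> /(gt _ _ pt qt) /and3P[/eqP n1 /eqP n2 /eqP n3]; exfalso.
  have [[rp ?]|[rp ?]|[rp ?]] := rayP _ pt; have [[rq ?]|[rq ?]|[rq ?]] := rayP _ qt;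
    try (by move: pq; rewrite rp rq);
  first [apply: n1; lra|apply: n2; lra|apply: n3; lra].
by move=> n /mapP[p /rayP[[-> _]|[-> _]|[-> _]] ->].
Qed.

(** * Consequences of determining finitely many lines *)

Lemma determinesP {R : realType} (P : set (R * R)) (c : R * R) :
  determines P (tropical_line c) <->
  exists p q, [/\ P p, P q, p != q, on_rays c p & on_rays c q].
Proof.
split=> [[_ /card_ge2P[p [q [[Pp cp] [Pq cq] pq]]]]|[p [q [Pp Pq pq cp cq]]]].
  by exists p, q; split=> //; exact/tropical_line_raysP.
split; first by exists c.
by apply/card_ge2P; exists p, q; split=> //; split=> //; exact/tropical_line_raysP.
Qed.

Lemma finite_determines_generic {R : realType} (P : set (R * R)) :
  finite_set [set L : set (R * R) | determines P L] ->
  forall p q, P p -> P q -> p != q -> generic p q.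
Proof.
move=> fin p q Pp Pq pq.
have key (c : nat -> R * R) : injective c ->
    (forall n, on_rays (c n) p /\ on_rays (c n) q) -> False.
  move=> cI cpq;
  apply: (infinite_range _ (fun n => tropical_line (c n)) _ _ fin).
    by move=> m n /tropical_line_inj /cI.
  by move=> n; apply/determinesP; exists p, q; have [? ?] := cpq n; split.
have N0 n : 0 <= n%:R :> R by rewrite ler0n.
have NI (a : R) : injective (fun n : nat => a + n%:R).
  by move=> m n /addrI /eqP; rewrite eqr_nat => /eqP.
have NJ (a : R) : injective (fun n : nat => a - n%:R).
  by move=> m n /addrI /oppr_inj /eqP; rewrite eqr_nat => /eqP.
apply/and3P; split; apply/eqP => e.
(* In each case the center starts where both points lie on the same ray and recedes against the
   direction of that ray as [n] grows. *)
- apply: (key (fun n => (p.1, Num.max p.2 q.2 + n%:R))) => [m n [] /NI //|n].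
  have := N0 n; have := lexx (Num.max p.2 q.2); rewrite {1}ge_max => /andP[? ?] ?.
  by split; apply: Or32; split => //=; lra.
- apply: (key (fun n => (Num.max p.1 q.1 + n%:R, p.2))) => [m n [] /NI //|n].
  have := N0 n; have := lexx (Num.max p.1 q.1); rewrite {1}ge_max => /andP[? ?] ?.
  by split; apply: Or33; split => //=; lra.
- apply: (key (fun n => (Num.min p.1 q.1 - n%:R, Num.min p.1 q.1 - n%:R - (p.1 - p.2)))).
    by move=> m n [] /NJ.
  move=> n; have := N0 n; have := lexx (Num.min p.1 q.1).
  rewrite {1}le_min => /andP[? ?] ?.
  by split; apply: Or31; split => //=; lra.
Qed.

(** Joining each point to [a] or [b] covers [P] by the finitely many determined lines, and each of
    them meets [P] in at most one point per ray. *)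
Lemma finite_determines_finite {R : realType} (P : set (R * R)) :
  (`I_2 #<= P)%card ->
  finite_set [set L : set (R * R) | determines P L] -> finite_set P.
Proof.
move=> /card_ge2P[a [b [Pa Pb ab]]] fin.
have gen := finite_determines_generic P fin.
have sub1 (A : set (R * R)) :
    (forall p q, A p -> A q -> p = q) -> finite_set A.
  move=> A1; have [->|/set0P[x Ax]] := eqVneq A set0; first exact: finite_set0.
  by apply: (sub_finite_set _ (finite_set1 x)) => y Ay; exact: A1.
apply: (@sub_finite_set _ _ (\bigcup_(L in [set L | determines P L]) (P `&` L))).
  move=> p Pp.
  have [q Pq pq] : exists2 q, P q & p != q.
    by have [pa|] := eqVneq p a; [exists b; rewrite ?pa|exists a].
  have [c [cp cq]] := tropical_line_through p q.
  exists (tropical_line c); last by split => //; exact/tropical_line_raysP.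
  by apply/determinesP; exists p, q.
apply: bigcup_finite => // L [[c ->] _].
apply: (@sub_finite_set _ _ ((P `&` [set p | p.1 - p.2 = c.1 - c.2]) `|`
   (P `&` [set p | p.1 = c.1]) `|` (P `&` [set p | p.2 = c.2]))).
  move=> p [Pp /tropical_line_raysP[[e _]|[e _]|[e _]]];
  [left; left|left; right|right]; split=> //=; lra.
rewrite !finite_setU; split; first split; apply: sub1 => p q [Pp ep] [Pq eq];
  apply/eqP; apply: contraT => /(gen _ _ Pp Pq) /and3P[];
  by rewrite ep eq eqxx.
Qed.

Theorem theoremB (R : realType) (P : set (R * R)) (col : R * R -> colour)
    (hP : (`I_4 #<= P)%card)
    (hfin : finite_set [set L : set (R * R) | determines P L]) :
  exists L : set (R * R), determines P L /\ monochromatic P col L.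
Proof.
have P2 : (`I_2 #<= P)%card by apply: card_le_trans hP; rewrite card_le_II.
have gen := finite_determines_generic P hfin.
have /finite_seqP[s0 Ps0] := finite_determines_finite P P2 hfin.
set s := undup s0.
have sP p : p \in s -> P p by rewrite Ps0 mem_undup.
have Ps p : P p -> p \in s by rewrite Ps0 mem_undup.
have szs : (4 <= size s)%N.
  apply: card_ge_size; suff -> : [set` s] = P by [].
  by apply/seteqP; split => p /=; [exact: sP|exact: Ps].
apply: contrapT => nomono.
pose red p := if col p is Red then true else false.
have colE p q : red p = red q -> col p = col q.
  by rewrite /red; case: (col p); case: (col q).
suff : (size s <= 3)%N by rewrite leqNgt szs.
(* Abstract lines are represented by centers, so uniqueness of the join is uniqueness of the
   center. *)
apply: (@bichromatic_size_le3 _ _ on_rays s red).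
- exact: undup_uniq.
- by move=> p q _ _ _; exact: tropical_line_through.
- move=> c d p q /sP Pp /sP Pq /(gen _ _ Pp Pq); exact: on_rays_uniq.
- move=> c t ut ts; apply: generic_line_le3 => // p q /ts/sP Pp /ts/sP Pq.
  exact: gen.
(* Were every point of [P] on the line coloured like [p], the line would be monochromatic, against
   [nomono]. *)
- move=> c p q /sP Pp /sP Pq pq cp cq _; apply: contrapT => nz.
  apply: nomono; exists (tropical_line c); split.
    by apply/determinesP; exists p, q.
  exists (col p) => z [Pz /tropical_line_raysP cz]; apply: colE.
  by apply: contrapT => /eqP zp; apply: nz; exists z; split=> //; exact: Ps.
Qed.
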